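(* For all integers $n, k \geq 2$, we have $$F_{n+k-2}^{(k)} = 2^{n-2} \sum_{0 \leq \ell \leq \frac{n-1}{k+1}} \left[\binom{(k+1)\ell-n}{\ell} - \binom{(k+1)\ell-n}{\ell-1}\right] 2^{-(k+1)\ell} ,$$ where the sum is over the integers $\ell$ in the indicated range.
   Context: For an integer $k \geq 2$, the $k$-Fibonacci sequence $(F_n^{(k)})_{n \geq 0}$ is the integer sequence defined by $F_0^{(k)} = F_1^{(k)} = \dots = F_{k-2}^{(k)} = 0$, $F_{k-1}^{(k)} = 1$, and $F_{n+k}^{(k)} = F_n^{(k)} + F_{n+1}^{(k)} + \dots + F_{n+k-1}^{(k)}$ for all integers $n \geq 0$. For $a, b \in \mathbb{Z}$, the generalized binomial coefficient is defined by $\binom{a}{b} := \frac{a(a-1)\cdots(a-b+1)}{b!}$ if $b \geq 0$; $\binom{a}{b} := \binom{a}{a-b}$ if $b < 0$ and $a \geq b$; and $\binom{a}{b} := 0$ if $a < b < 0$. *)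

(* Defs.v *)
From mathcomp Require Import all_boot all_order all_algebra.

Set Implicit Arguments.
Unset Strict Implicit.
Unset Printing Implicit Defensive.

Import Order.TTheory GRing.Theory Num.Theory.
Local Open Scope ring_scope.

(* [:: F_0; ...; F_(n-1)] for the k-Fibonacci sequence F. *)
Fixpoint kfib_prefix (k n : nat) : seq int :=
  if n is m.+1 then
    let s := kfib_prefix k m in
    rcons s (if (m < k - 1)%N then 0
             else if m == (k - 1)%N then 1
             else \sum_(m - k <= i < m) s`_i)
  else [::].

Definition kfib (k n : nat) : int := (kfib_prefix k n.+1)`_n.

Lemma size_kfib_prefix k n : size (kfib_prefix k n) = n.
Proof. by elim: n => //= n IHn; rewrite size_rcons IHn. Qed.

Lemma nth_kfib_prefix k n i : (i < n)%N -> (kfib_prefix k n)`_i = kfib k i.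
Proof.
elim: n => // n IHn; rewrite ltnS leq_eqVlt => /orP[/eqP-> // | lt_in].
by rewrite -IHn //= nth_rcons size_kfib_prefix lt_in.
Qed.

Lemma kfibE k n :
  kfib k n = if (n < k - 1)%N then 0
             else if n == (k - 1)%N then 1
             else \sum_(n - k <= i < n) kfib k i.
Proof.
rewrite {1}/kfib /= nth_rcons size_kfib_prefix ltnn eqxx.
case: ifP => // _; case: ifP => // _.
by apply: eq_big_nat => i /andP[_ lt_in]; rewrite nth_kfib_prefix.
Qed.

Lemma kfib_small k n : (n < k - 1)%N -> kfib k n = 0.
Proof. by move=> lt_nk; rewrite kfibE lt_nk. Qed.

Lemma kfib_one k : kfib k (k - 1) = 1.
Proof. by rewrite kfibE ltnn eqxx. Qed.

Lemma kfib_rec k n : (2 <= k)%N ->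
  kfib k (n + k) = \sum_(i < k) kfib k (n + i).
Proof.
move=> k_ge2; have lt_k : (k - 1 < n + k)%N.
  by rewrite (leq_trans _ (leq_addl n k)) // subn1 prednK // ltnW.
rewrite kfibE ltnNge (ltnW lt_k) /= gtn_eqF // addnK.
rewrite -{1}[n]add0n big_addn addKn big_mkord.
by apply: eq_bigr => i _; rewrite addnC.
Qed.

Definition ffact_binom (a : int) (m : nat) : rat :=
  (\prod_(i < m) (a - i%:Z))%:~R / m`!%:R.

Definition gbinom (a b : int) : rat :=
  if 0 <= b then ffact_binom a `|b|
  else if b <= a then ffact_binom a `|a - b|
  else 0.

(* Main.v *)
Require Import Defs.
From mathcomp Require Import all_boot all_order all_algebra.
From mathcomp Require Import ring zify.

Import Order.TTheory GRing.Theory Num.Theory.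
Local Open Scope ring_scope.

(** Telescoping explains the formula. Let P(M) be the sum of the first M terms
    of the k-Fibonacci sequence. Because every term past the initial ones is
    the sum of its k predecessors, P(M+k) - P(M) is the term of index M+k, hence
    P(M+k+1) = 2 P(M+k) - P(M), a recurrence involving only three values
    of P ([kfib_sum_rec]). Since P vanishes below k and P(k) = 1, the generating
    series of m |-> P(m+k) is 1 / (1 - 2x + x^(k+1)), whose expansion as a
    geometric series in 2x - x^(k+1) gives
      P(m+k) = \sum_l (-1)^l 'C(m - kl, l) 2^(m - (k+1)l)
    ([kfib_sum_closed]); here this is checked by induction, Pascal's rule
    being exactly the recurrence term by term.

    The wanted term of the sequence is a difference of two consecutive P, so it
    remains to match summands. As (k+1)l - n is negative on the range of
    summation, upper negation [ffact_binom_neg] turns the generalized binomials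
    into ordinary ones, the minus sign between them becomes a plus, and one
    more use of Pascal's rule yields the difference of the two closed forms
    ([gbinom_summand]). *)

(** * Partial sums of the k-Fibonacci sequence *)

Definition kfib_sum (k M : nat) : int := \sum_(j < M) kfib k j.

Lemma kfib_sumS k M : kfib_sum k M.+1 = kfib_sum k M + kfib k M.
Proof. by rewrite /kfib_sum big_ord_recr. Qed.

Lemma kfib_sum_small k M : (M < k)%N -> kfib_sum k M = 0.
Proof.
move=> ltMk; apply: big1 => j _; apply: kfib_small.
by have := ltn_ord j; lia.
Qed.

Lemma kfib_sum_first k : (0 < k)%N -> kfib_sum k k = 1.
Proof.
case: k => // k _; rewrite kfib_sumS kfib_sum_small // add0r.
by have := kfib_one k.+1; rewrite subn1.
Qed.

(** The defining recurrence says that the term of index [M + k] is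
    [kfib_sum k (M + k) - kfib_sum k M]. *)
Lemma kfib_sum_rec k M : (2 <= k)%N ->
  kfib_sum k (M + k).+1 = 2 * kfib_sum k (M + k) - kfib_sum k M.
Proof.
move=> hk; rewrite kfib_sumS kfib_rec //.
have -> : kfib_sum k (M + k) = kfib_sum k M + \sum_(i < k) kfib k (M + i).
  by rewrite /kfib_sum big_split_ord.
by ring.
Qed.

(** * The expansion of 1 / (1 - 2x + x^(k+1)) *)

(** Powers of 2 are divided in [rat] and only the subtraction inside the
    binomial is truncated; this is harmless, the binomial being 0 whenever
    [m < k.+1 * l] ([expansion_term_eq0]). *)
Definition expansion_term (k m l : nat) : rat :=
  (-1) ^+ l * 'C(m - k * l, l)%:R * 2 ^+ m / 2 ^+ (k.+1 * l).

Definition expansion (k m : nat) : rat :=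
  \sum_(l < m.+1) expansion_term k m l.

Lemma expansion_term0 k m : expansion_term k m 0 = 2 ^+ m.
Proof. by rewrite /expansion_term !muln0 bin0 !expr0 divr1 !mul1r. Qed.

Lemma expansion_term_eq0 k m l :
  (m < k.+1 * l)%N -> expansion_term k m l = 0.
Proof.
rewrite mulSn => lt_m; rewrite /expansion_term bin_small ?mulr0 ?mul0r //.
by lia.
Qed.

(** All bounds past the last nonzero term give the same sum, so bounds can be
    aligned when comparing expansions with different [m]. *)
Lemma expansion_widen k m B :
  (m < k.+1 * B)%N -> expansion k m = \sum_(l < B) expansion_term k m l.
Proof.
have bound B1 B2 : (B1 <= B2)%N -> (m < k.+1 * B1)%N ->
    \sum_(l < B1) expansion_term k m l = \sum_(l < B2) expansion_term k m l.
  move=> leB hB1; rewrite -!(big_mkord xpredT (expansion_term k m)).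
  rewrite (big_cat_nat (leq0n B1) leB) /= [X in _ = _ + X]big1_seq ?addr0 //.
  move=> l; rewrite mem_index_iota => /and3P[_ le_B1l _].
  by apply: expansion_term_eq0; nia.
move=> hB; have [le_mB|lt_Bm] := leqP m.+1 B; first by apply: bound; nia.
by symmetry; apply: bound => //; apply: ltnW.
Qed.

Lemma expansion_small k m : (m <= k)%N -> expansion k m = 2 ^+ m.
Proof.
move=> le_mk; rewrite (expansion_widen k m 1) ?muln1 //.
by rewrite big_ord1 expansion_term0.
Qed.

(** Pascal's rule for ['C((m + k).+1 - k * l.+1, l.+1)]; when [m < k * l] the
    truncated subtractions break the rule, but then all terms vanish. *)
Lemma expansion_term_rec k m l :
  expansion_term k (m + k).+1 l.+1 =
  2 * expansion_term k (m + k) l.+1 - expansion_term k m l.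
Proof.
have [le_klm|lt_mkl] := leqP (k * l) m; last first.
  by rewrite !expansion_term_eq0 ?mulr0 ?subr0 //; nia.
rewrite /expansion_term.
have -> : ((m + k).+1 - k * l.+1 = (m - k * l).+1)%N by nia.
have -> : (m + k - k * l.+1 = m - k * l)%N by nia.
have -> : (k.+1 * l.+1 = k.+1 * l + k.+1)%N by nia.
move: (k.+1 * l)%N => e; rewrite binS natrD !exprS !exprD !exprS.
have pow2_neq0 j : 2 ^+ j != 0 :> rat by rewrite expf_neq0.
by field; rewrite !pow2_neq0.
Qed.

Lemma expansion_rec k m :
  expansion k (m + k).+1 = 2 * expansion k (m + k) - expansion k m.
Proof.
rewrite (expansion_widen k (m + k).+1 (m + k).+2); last by nia.
rewrite (expansion_widen k (m + k) (m + k).+2); last by nia.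
rewrite (expansion_widen k m (m + k).+1); last by nia.
rewrite [LHS]big_ord_recl [X in 2 * X]big_ord_recl !expansion_term0.
rewrite mulrDr -exprS -addrA; congr (_ + _).
rewrite mulr_sumr -sumrB; apply: eq_bigr => l _.
exact: expansion_term_rec.
Qed.

(** Both sides satisfy the same recurrence; for [m < k] its last term is 0 on
    the left and absent on the right, and both sides are [2 ^+ m.+1]. *)
Lemma kfib_sum_closed k m : (2 <= k)%N ->
  (kfib_sum k (m + k))%:~R = expansion k m.
Proof.
move=> hk; have [N le_mN] := ubnP m; elim: N m le_mN => // N IHN [|m] le_mN.
  by rewrite add0n kfib_sum_first ?expansion_small // ltnW.
rewrite addSn kfib_sum_rec // rmorphB rmorphM /= IHN //.
have [lt_mk|le_km] := ltnP m k.
  rewrite kfib_sum_small // subr0 !expansion_small ?exprS //.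
  exact: ltnW.
have -> : kfib_sum k m = kfib_sum k (m - k + k) by rewrite subnK.
rewrite IHN; last by lia.
by have := expansion_rec k (m - k); rewrite subnK.
Qed.

(** * Generalized binomials with a negative upper entry *)

Lemma prod_neg_ffact N l :
  \prod_(i < l) (- N.+1%:Z - i%:Z) = (-1) ^+ l * ((N + l) ^_ l)%:Z.
Proof.
elim: l => [|l IHl]; first by rewrite big_ord0 ffactn0.
rewrite big_ord_recr /= {}IHl addnS ffactSS PoszM exprS.
have -> : (N + l).+1%:Z = N%:Z + l%:Z + 1 by lia.
have -> : N.+1%:Z = N%:Z + 1 by lia.
by ring.
Qed.

Lemma ffact_binom_neg N l :
  ffact_binom (- N.+1%:Z) l = (-1) ^+ l * 'C(N + l, l)%:R.
Proof.
rewrite /ffact_binom prod_neg_ffact -bin_ffact PoszM mulrA !rmorphM /=.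
rewrite rmorphXn /= rmorphN1 mulfK // pnatr_eq0 -lt0n.
exact: fact_gt0.
Qed.

(** The case [l = 0] is apart: its second binomial has lower entry -1, and
    vanishes because the upper entry is at most -2. *)
Lemma gbinom_summand k m l : (k.+1 * l <= m.+1)%N ->
  2 ^+ m * ((gbinom ((k%:Z + 1) * l%:Z - m.+2%:Z) l%:Z
             - gbinom ((k%:Z + 1) * l%:Z - m.+2%:Z) (l%:Z - 1))
            * 2 ^- (k.+1 * l)) =
  expansion_term k m.+1 l - expansion_term k m l.
Proof.
case: l => [_|l le_lm].
  rewrite !expansion_term0 mulr0 sub0r muln0 /gbinom /=.
  rewrite ffact_binom_neg bin0 exprS expr0 invr1; ring.
have [N defm] : exists N, m.+1 = (k.+1 * l.+1 + N)%N.
  by exists (m.+1 - k.+1 * l.+1)%N; rewrite subnKC.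
have -> : (k%:Z + 1) * l.+1%:Z - m.+2%:Z = - N.+1%:Z by rewrite defm; nia.
have -> : l.+1%:Z - 1 = l%:Z by lia.
rewrite /gbinom /= !ffact_binom_neg /expansion_term.
have -> : (m.+1 - k * l.+1 = (N + l).+1)%N by nia.
have -> : (m - k * l.+1 = N + l)%N by nia.
rewrite addnS binS natrD !exprS; ring.
Qed.

Theorem theorem3p7 (n k : nat) (hn : (2 <= n)%N) (hk : (2 <= k)%N) :
  (kfib k (n + k - 2))%:~R =
    2 ^+ (n - 2) *
    \sum_(0 <= l < ((n - 1) %/ (k + 1)).+1)
      (gbinom ((k%:Z + 1) * l%:Z - n%:Z) l%:Z
       - gbinom ((k%:Z + 1) * l%:Z - n%:Z) (l%:Z - 1))
      * 2 ^- ((k + 1) * l) :> rat.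
Proof.
case: n hn => [|[|m]] // _.
rewrite !addSn !subSS !subn0 addn1 big_mkord.
have -> : kfib k (m + k) = kfib_sum k (m.+1 + k) - kfib_sum k (m + k).
  by rewrite addSn kfib_sumS; ring.
rewrite rmorphB /= !kfib_sum_closed //.
set B := (m.+1 %/ k.+1).+1.
have lt_mB : (m.+1 < k.+1 * B)%N by rewrite mulnC ltn_ceil.
rewrite (expansion_widen _ _ _ lt_mB) (expansion_widen _ _ _ (ltnW lt_mB)).
rewrite -sumrB mulr_sumr; apply: eq_bigr => l _; rewrite gbinom_summand //.
by rewrite mulnC -leq_divRL // -ltnS.
Qed.
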